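(* Let $-1<\beta<-1/3$ and let $m\geq1$ be an integer. For $j\in\{m,m+1\}$ put $\omega_j=\sqrt{j(j+\beta)}$, $$Y_j(\theta):=Q_j^{(\beta)}(\cos\theta),\qquad r_j(\theta):=\left(Y_j(\theta)^2+\frac{Y_j'(\theta)^2}{\omega_j^2}\right)^{1/2},$$ and choose the local phase $\phi_j$ (continuous, for $\theta\ge 0$ near $0$) by $$Y_j=r_j\cos\phi_j,\qquad Y_j'=-\omega_jr_j\sin\phi_j,\qquad \phi_j(0)=0.$$ Let $\Theta_j$ denote the local inverse of $\phi_j$ near $0$ and set $R_j=r_j\circ\Theta_j$. Then, as $s\downarrow0$, $$R_{m+1}(s)-R_m(s)=\frac{3\beta+1}{4}\left(\frac1{\omega_m^2}-\frac1{\omega_{m+1}^2}\right)s^4+O(s^6).$$ Consequently, $R_{m+1}(s)<R_m(s)$ for all sufficiently small $s>0$.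
   Context: $P_n^{(\alpha,\beta)}$ is the Jacobi polynomial of degree $n$ normalised by $P_n^{(\alpha,\beta)}(1)=(\alpha+1)_n/n!$. For $\beta>-1$ and integers $j\geq1$, $$Q_j^{(\beta)}(x)=2^{-\beta-1}(1+x)^{\beta+1}P_{j-1}^{(0,\beta+1)}(x).$$ One has $Y_j(0)=1$, and $\phi_j$ is strictly increasing near $\theta=0$, so the local inverse makes sense. *)

(* Defs.v *)
From HB Require Import structures.
From mathcomp Require Import all_boot all_order all_algebra.
From mathcomp Require Import all_classical all_reals all_analysis.
Set Implicit Arguments.
Unset Strict Implicit.
Unset Printing Implicit Defensive.
Import Order.TTheory GRing.Theory Num.Theory.
Import numFieldNormedType.Exports.
Local Open Scope classical_set_scope.
Local Open Scope ring_scope.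

Definition pochhammer (R : pzSemiRingType) (a : R) (n : nat) : R :=
  \prod_(i < n) (a + i%:R).

(* P_n^(alpha, beta), as a polynomial in x: this is
   (alpha + 1)_n / n! * 2F1(-n, n + alpha + beta + 1; alpha + 1; (1 - x) / 2),
   with the denominators (alpha + 1)_k cancelled against (alpha + 1)_n, so that
   no condition on alpha is needed. *)
Definition jacobi (R : fieldType) (alpha beta : R) (n : nat) : {poly R} :=
  (n`!%:R)^-1 *: \sum_(k < n.+1)
    ('C(n, k)%:R * pochhammer (n%:R + alpha + beta + 1) k
       * pochhammer (alpha + k%:R + 1) (n - k))
      *: (2^-1 *: ('X - 1)) ^+ k.

Lemma jacobi1 (R : fieldType) (alpha beta : R) (n : nat) :
  (jacobi alpha beta n).[1] = pochhammer (alpha + 1) n / n`!%:R.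
Proof.
rewrite /jacobi hornerZ horner_sum big_ord_recl big1 => [|i _] /=.
  by rewrite addr0 bin0 subn0 /pochhammer big_ord0 addr0 !mulr1 mul1r alg_polyC
    hornerC mulrC.
by rewrite !hornerE subrr mulr0 expr0n mulr0.
Qed.

Section Jacobi_phase.
Variable R : realType.
Implicit Types (beta theta : R) (j : nat) (phi Theta : R -> R).

Definition Q beta j (x : R) : R :=
  2 `^ (- beta - 1) * (1 + x) `^ (beta + 1) * (jacobi 0 (beta + 1) j.-1).[x].

Definition omega beta j : R := Num.sqrt (j%:R * (j%:R + beta)).

Definition Y beta j theta : R := Q beta j (cos theta).

Definition r beta j theta : R :=
  Num.sqrt (Y beta j theta ^+ 2
            + (Y beta j)^`()%classic theta ^+ 2 / omega beta j ^+ 2).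

(* Only the germ of phi at 0 on the side theta >= 0 matters. *)
Definition is_local_phase beta j phi : Prop :=
  phi 0 = 0 /\
  exists2 d : R, 0 < d &
    {within `[0, d], continuous phi} /\
    forall theta, 0 <= theta <= d ->
      Y beta j theta = r beta j theta * cos (phi theta) /\
      (Y beta j)^`()%classic theta = - omega beta j * r beta j theta * sin (phi theta).

(* Theta is a two-sided inverse of the germ of phi at 0: both maps act between
   one-sided neighbourhoods of 0 in [0, +oo[. *)
Definition is_local_inverse phi Theta : Prop :=
  exists d e : R, [/\ 0 < d, 0 < e,
    forall theta, 0 <= theta <= d -> Theta (phi theta) = theta &
    forall s, 0 <= s <= e -> 0 <= Theta s <= d /\ phi (Theta s) = s].

End Jacobi_phase.

(* Main.v *)
(* In the variable t = (1 - cos theta) / 2 the function Y_j becomes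
   g(t) = (1 - t)^(beta + 1) p(t) with p a polynomial, and with lambda = omega_j^2,
     g(t) = 1 - lambda t + lambda (lambda + beta - 1) / 4 t^2 + O(t^3).
   Put w = Y_j'^2 / lambda = t (1 - t) g'(t)^2 / lambda.  Eliminating t between
   r_j^2 = g^2 + w and w gives
     r_j^2 = 1 - w - K_j w^2 + O(w^3),  K_j = 1/2 + (3 beta + 1) / (2 lambda).
   At theta = Theta_j(s) one has w = r_j^2 v with v = sin^2 s, the same v for
   both values of j, so subtracting the two expansions leaves
     R_(m+1) - R_m = - (K_(m+1) - K_m) / 2 v^2 + O(v^3),
   and v = s^2 + O(s^4).  No expansion of phi_j or Theta_j is needed: only that
   Theta_j(s) tends to 0 from the right, which follows from the intermediate
   value theorem applied to phi_j. *)

Require Import Defs.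
From HB Require Import structures.
From mathcomp Require Import all_boot all_order all_algebra.
From mathcomp Require Import all_classical all_reals all_analysis.
From mathcomp Require Import ring lra.
Import Order.TTheory GRing.Theory Num.Theory.
Import numFieldNormedType.Exports.
Local Open Scope classical_set_scope.
Local Open Scope ring_scope.

(* An error term O(x^n) is written x^n * E x with E eventually bounded, so that
   expansions are exact equalities and remainders are computed by ring and field. *)
Definition ebounded (R : numDomainType) (T : Type) (F : set_system T) (f : T -> R) :=
  exists C : R, \forall x \near F, `|f x| <= C.
Arguments ebounded {R T}.

(** * Algebra of eventually bounded functions *)

Section Bounded.
Context {R : realType} {T : Type} {F : set_system T} {FF : Filter F}.
Implicit Types f g : T -> R.

Lemma eboundedD f g :
  ebounded F f -> ebounded F g -> ebounded F (fun x => f x + g x).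
Proof.
move=> [C HC] [D HD]; exists (C + D); near=> x.
by rewrite (le_trans (ler_normD _ _))// lerD//; near: x.
Unshelve. all: by end_near. Qed.

Lemma eboundedM f g :
  ebounded F f -> ebounded F g -> ebounded F (fun x => f x * g x).
Proof.
move=> [C HC] [D HD]; exists (C * D); near=> x.
by rewrite normrM ler_pM//; near: x.
Unshelve. all: by end_near. Qed.

Lemma eboundedN f : ebounded F f -> ebounded F (fun x => - f x).
Proof. by move=> [C HC]; exists C; under eq_near do rewrite normrN. Qed.

Lemma ebounded_cst (c : R) : ebounded F (fun=> c).
Proof. by exists `|c|; near=> x. Unshelve. all: by end_near. Qed.

Lemma eboundedX f n : ebounded F f -> ebounded F (fun x => f x ^+ n).
Proof.
move=> [C HC]; exists (C ^+ n); near=> x.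
by rewrite normrX lerXn2r ?nnegrE// ?(le_trans (normr_ge0 (f x)))//; near: x.
Unshelve. all: by end_near. Qed.

Lemma eboundedV f (c : R) : 0 < c -> (\forall x \near F, c <= f x) ->
  ebounded F (fun x => (f x)^-1).
Proof.
move=> c0 cf; exists c^-1; near=> x.
have cfx : c <= f x by near: x.
by rewrite ger0_norm ?invr_ge0 ?lef_pV2 ?posrE// ?(le_trans (ltW c0))// (lt_le_trans c0).
Unshelve. all: by end_near. Qed.

Lemma ebounded_cvg f (l : R) : f x @[x --> F] --> l -> ebounded F f.
Proof.
move=> /cvgrPdist_le /(_ 1 ltr01) H; exists (`|l| + 1); near=> x.
rewrite -[f x](subKr l) (le_trans (ler_normB _ _))// lerD2l.
by near: x.
Unshelve. all: by end_near. Qed.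

End Bounded.

(** * Raising the order of an error term by integration *)

Section Integrate.
Context {R : realType}.
Implicit Types f g : R -> R.

Lemma ebounded_id : ebounded (0^'+) (fun x : R => x).
Proof.
exists 1; near=> x; rewrite ger0_norm//; near: x; exact: nbhs_right_le.
Unshelve. all: by end_near. Qed.

(** By the mean value theorem f(t) = t f'(c) with 0 < c < t, so f(t) / t^(n+1) = E(c) (c/t)^n is
    bounded by the same constant as E. *)
Lemma integrate_expansion (f df E : R -> R) n :
  f 0 = 0 -> (\forall x \near (0:R), is_derive x (1:R) f (df x)) ->
  ebounded (0^'+) E -> (\forall x \near 0^'+, df x = x ^+ n * E x) ->
  exists2 G, ebounded (0^'+) G & \forall x \near 0^'+, f x = x ^+ n.+1 * G x.
Proof.
move=> f0 Df [C HC] dfE; exists (fun x => f x / x ^+ n.+1); last first.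
  near=> x; rewrite mulrCA divff ?mulr1// expf_neq0// gt_eqF//.
exists C.
have [e e0 De] : exists2 e : R, 0 < e & forall x : R, `|x| < e -> is_derive x (1:R) f (df x).
  by move: Df => /nbhs_norm0P[e e0 H]; exists e => // x xe; apply: H.
have [d d0 Hd] : exists2 d : R, 0 < d &
    forall x : R, 0 < x < d -> df x = x ^+ n * E x /\ `|E x| <= C.
  have : \forall x \near (0:R)^'+, df x = x ^+ n * E x /\ `|E x| <= C.
    by apply: filterS2 dfE HC => x.
  move=> [d d0 H]; exists d => // x /andP[x0 xd].
  by apply: H => //=; rewrite sub0r normrN gtr0_norm.
near=> t.
have t0 : 0 < t by [].
have te : t < e by near: t; exact: nbhs_right_lt.
have td : t < d by near: t; exact: nbhs_right_lt.
have [||c] := @MVT _ f df 0 t t0.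
- move=> x; rewrite in_itv/= => /andP[x0 xt]; apply: De.
  by rewrite gtr0_norm// (lt_trans xt).
- apply: derivable_within_continuous => x; rewrite in_itv/= => /andP[x0 xt].
  by have [] := De x; rewrite ?ger0_norm ?(le_lt_trans xt).
rewrite in_itv/= f0 !subr0 => /andP[c0 ct] ->.
have [->Ec] : df c = c ^+ n * E c /\ `|E c| <= C by apply: Hd; rewrite c0 (lt_trans ct).
rewrite exprS invfM mulrA mulfK ?gt_eqF// mulrAC normrM.
rewrite -[leRHS]mul1r ler_pM// normrM normfV !normrX !gtr0_norm// -expr_div_n.
by rewrite exprn_ile1// ?divr_ge0 ?ler_pdivrMr ?mul1r ?ltW.
Unshelve. all: by end_near. Qed.

End Integrate.

(** * Expansions at 0 of powers of 1 - t, of the sine and of polynomials *)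

Section Expansions.
Context {R : realType}.
Implicit Types a : R.

Lemma is_derive_powR_onem a (t : R) : t < 1 ->
  is_derive t (1:R) (fun t => (1 - t) `^ a) (- a * (1 - t) `^ (a - 1)).
Proof.
move=> t1; have D : is_derive t (1:R) (fun t : R => 1 - t) (-1).
  by apply: is_derive_eq; rewrite add0r mul1r.
have := @is_derive1_comp R (fun x => x `^ a) _ t _ _ (is_derive1_powR _ _) D.
by rewrite subr_gt0 mulrN1 -mulNr; apply.
Qed.

Lemma near_lt1 : \forall t \near (0:R), t < 1.
Proof. exact: lt_nbhsl. Qed.

Lemma powR_onem_expansion0 a : ebounded (0^'+) (fun t : R => (1 - t) `^ a).
Proof.
have D := is_derive_powR_onem a 0 ltr01.
have /derivable1_diffP/differentiable_continuous C := @ex_derive _ _ _ _ _ _ _ D.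
by apply: (@ebounded_cvg _ _ _ _ _ ((1 - 0) `^ a)); apply: cvg_at_right_filter.
Qed.

(** The derivative of (1 - t)^a is -a (1 - t)^(a - 1), so each order follows by integrating the
    previous one at exponent [a - 1]. This is why every order is stated for all [a]. *)
Lemma powR_onem_expansion1 a : exists2 E, ebounded (0^'+) E &
  \forall t \near 0^'+, (1 - t) `^ a = 1 + t * E t.
Proof.
have [||||G bG HG] := @integrate_expansion _ (fun t : R => (1 - t) `^ a - 1)
  (fun t => - a * (1 - t) `^ (a - 1)) (fun t => - a * (1 - t) `^ (a - 1)) 0.
- by rewrite subr0 powR1 subrr.
- near=> t; have t1 : t < 1 by near: t; exact: near_lt1.
  have ? := is_derive_powR_onem a t t1.
  by apply: is_derive_eq; rewrite subr0.
- by apply: eboundedM; [exact: ebounded_cst|exact: powR_onem_expansion0].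
- by near=> t; rewrite expr0 mul1r.
exists G => //; near=> t.
have : (1 - t) `^ a - 1 = t ^+ 1 * G t by near: t.
by rewrite expr1 => <-; ring.
Unshelve. all: by end_near. Qed.

Lemma powR_onem_expansion2 a : exists2 E, ebounded (0^'+) E &
  \forall t \near 0^'+, (1 - t) `^ a = 1 - a * t + t ^+ 2 * E t.
Proof.
have [E bE HE] := powR_onem_expansion1 (a - 1).
have [||||G bG HG] := @integrate_expansion _ (fun t : R => (1 - t) `^ a - 1 + a * t)
  (fun t => - a * (1 - t) `^ (a - 1) + a) (fun t => - a * E t) 1.
- by rewrite subr0 powR1 subrr mulr0 addr0.
- near=> t; have t1 : t < 1 by near: t; exact: near_lt1.
  have ? := is_derive_powR_onem a t t1.
  by apply: is_derive_eq; rewrite subr0 !scaler1.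
- by apply: eboundedM => //; exact: ebounded_cst.
- near=> t; have -> : (1 - t) `^ (a - 1) = 1 + t * E t by near: t.
  by ring.
exists G => //; near=> t.
have : (1 - t) `^ a - 1 + a * t = t ^+ 2 * G t by near: t.
by move=> <-; ring.
Unshelve. all: by end_near. Qed.

Lemma powR_onem_expansion3 a : exists2 E, ebounded (0^'+) E &
  \forall t \near 0^'+,
    (1 - t) `^ a = 1 - a * t + a * (a - 1) / 2 * t ^+ 2 + t ^+ 3 * E t.
Proof.
have [E bE HE] := powR_onem_expansion2 (a - 1).
have [||||G bG HG] := @integrate_expansion _
  (fun t : R => (1 - t) `^ a - 1 + a * t - a * (a - 1) / 2 * t ^+ 2)
  (fun t => - a * (1 - t) `^ (a - 1) + a - a * (a - 1) * t) (fun t => - a * E t) 2.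
- by rewrite subr0 powR1; ring.
- near=> t; have t1 : t < 1 by near: t; exact: near_lt1.
  have ? := is_derive_powR_onem a t t1.
  by apply: is_derive_eq; rewrite subr0 !scaler1 /GRing.scale/=; field.
- by apply: eboundedM => //; exact: ebounded_cst.
- near=> t; have -> : (1 - t) `^ (a - 1) = 1 - (a - 1) * t + t ^+ 2 * E t by near: t.
  by ring.
exists G => //; near=> t.
have : (1 - t) `^ a - 1 + a * t - a * (a - 1) / 2 * t ^+ 2 = t ^+ 3 * G t by near: t.
by move=> <-; ring.
Unshelve. all: by end_near. Qed.

(** Three integrations, starting from the boundedness of cos: sin s = O(s), then cos s - 1 = O(s^2),
    then sin s - s = O(s^3). *)
Lemma sin_expansion : exists2 E, ebounded (0^'+) E &
  \forall s \near (0:R)^'+, sin s = s + s ^+ 3 * E s.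
Proof.
have [||||E bE HE] := @integrate_expansion R sin cos cos 0; first exact: sin0.
- by near=> x; exact: is_derive_sin.
- apply: (@ebounded_cvg _ _ _ _ _ (cos 0)); apply: cvg_at_right_filter.
  exact: continuous_cos.
- by near=> x; rewrite mul1r.
have [||||G bG HG] := @integrate_expansion R (fun x => cos x - 1) (fun x => - sin x)
  (fun x => - E x) 1; first by rewrite cos0 subrr.
- by near=> x; apply: is_derive_eq; rewrite subr0.
- exact: eboundedN.
- by near=> x; rewrite mulrN; congr (- _); near: x.
have [||||H bH HH] := @integrate_expansion R (fun x => sin x - x) (fun x => cos x - 1)
  G 2; first by rewrite sin0 subrr.
- by near=> x; apply: is_derive_eq.
- exact: bG.
- exact: HG.
exists H => //; near=> s; rewrite -[LHS](subrK s) addrC; congr (_ + _).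
by near: s.
Unshelve. all: by end_near. Qed.

Lemma poly_expansion (p : {poly R}) : exists q : {poly R},
  p = (p`_0)%:P + p`_1 *: 'X + p`_2 *: 'X^2 + 'X^3 * q.
Proof.
exists (drop_poly 3 p); apply/polyP => -[|[|[|i]]];
  rewrite !coefE ?coefXnM ?coefMXn ?coef_drop_poly/= ?(mulr0, addr0, mulr1, add0r, mulr1)//.
by rewrite subnK.
Qed.

Lemma ebounded_horner (p : {poly R}) : ebounded (0^'+) (fun t : R => p.[t]).
Proof.
apply: (@ebounded_cvg _ _ _ _ _ p.[0]); apply: cvg_at_right_filter.
exact: continuous_horner.
Qed.

End Expansions.

(** * First coefficients of the Jacobi polynomials at x = 1 *)

Section Algebra.
Context {R : realType}.

(** The summand [0] is the parameter alpha of [jacobi], kept so that the factor occurs literally. *)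
Lemma pochhammer_fact (k m : nat) :
  pochhammer (0 + k%:R + 1) m * k`!%:R = (k + m)`!%:R :> R.
Proof.
elim: m => [|m IHm]; first by rewrite /pochhammer big_ord0 mul1r addn0.
rewrite /pochhammer big_ord_recr/= -/(pochhammer _ m) mulrAC IHm addnS factS.
by rewrite natrM mulrC -addn1 !natrD; congr (_ * _); ring.
Qed.

Lemma natr_bin2 (n : nat) : 'C(n, 2)%:R = n%:R * (n%:R - 1) / 2 :> R.
Proof.
apply: (canRL (mulfK _)) => //.
have -> : 2 = 2`!%:R :> R by [].
rewrite -natrM bin_ffact; case: n => [|n]; first by rewrite mul0r.
by rewrite ffactnS ffactn1/= natrM -natr1; ring.
Qed.

(** For x = 1 - 2t the base (x - 1)/2 is -t, so the defining sum is already a polynomial in t. For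
    alpha = 0 the factor (k+1)_(n-k) equals n!/k! and cancels the prefactor 1/n!. *)
Lemma jacobi_onem2 (b : R) (n : nat) : exists2 p : {poly R},
  forall t, (jacobi 0 b n).[1 - 2 * t] = p.[t] &
  [/\ p`_0 = 1, p`_1 = - (n%:R * (n%:R + b + 1)) &
      p`_2 = n%:R * (n%:R - 1) * (n%:R + b + 1) * (n%:R + b + 2) / 4].
Proof.
pose c k : R := (n`!%:R)^-1 * ('C(n, k)%:R * pochhammer (n%:R + 0 + b + 1) k
       * pochhammer (0 + k%:R + 1) (n - k)) * (-1) ^+ k.
have nf : n`!%:R != 0 :> R by rewrite pnatr_eq0 -lt0n fact_gt0.
have cE k : c k = 'C(n, k)%:R * pochhammer (n%:R + b + 1) k * (-1) ^+ k / k`!%:R.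
  have [nk|kn] := ltnP n k; first by rewrite /c bin_small// !(mul0r, mulr0).
  have kf : k`!%:R != 0 :> R by rewrite pnatr_eq0 -lt0n fact_gt0.
  have := pochhammer_fact k (n - k); rewrite subnKC// => h.
  rewrite /c addr0 -h; set u := pochhammer _ (n - k).
  have u0 : u != 0 by apply: contraNneq nf => u0; rewrite -h -/u u0 mul0r.
  by field; rewrite u0 kf.
have cE0 k : (n < k)%N -> c k = 0 by move=> nk; rewrite cE bin_small// !mul0r.
exists (\poly_(k < n.+1) c k).
  move=> t; rewrite /jacobi hornerZ horner_sum horner_poly mulr_sumr.
  apply: eq_bigr => k _; rewrite hornerZ horner_exp hornerZ hornerD hornerN hornerX hornerC /c.
  have -> : 2^-1 * (1 - 2 * t - 1) = -1 * t by field.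
  by rewrite exprMn !mulrA.
(* The binomial vanishes for k > n, so the closed form also gives the coefficients 1 and 2 when n <
   2. *)
have coef k : (\poly_(k < n.+1) c k)`_k = c k.
  by rewrite coef_poly; case: ltnP => // /cE0.
rewrite !{}coef !cE /pochhammer !big_ord_recr !big_ord0/= bin0 bin1 natr_bin2.
split; first by rewrite !mulr1 divr1.
- by rewrite !mul1r divr1; ring.
- by rewrite -[2`!]/2%N; field.
Qed.

End Algebra.

Ltac ebounded_tac := repeat first
  [ assumption | exact: ebounded_cst | exact: ebounded_id
  | apply: eboundedN | apply: eboundedX | apply: eboundedM | apply: eboundedD ].

(** * Elimination of t between g and w *)

Section PhaseExpansion.
Context {R : realType}.

Lemma ebounded_small (T : Type) (F : set_system T) (f E : T -> R) (e : R) :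
  Filter F -> f x @[x --> F] --> 0 -> ebounded F E -> 0 < e ->
  \forall x \near F, `|f x * E x| <= e.
Proof.
move=> FF f0 [C HC] e0.
have C1 : 0 < `|C| + 1 by rewrite ltr_wpDl.
have H : \forall x \near F, `|0 - f x| <= e / (`|C| + 1).
  by move/cvgrPdist_le : f0; apply; rewrite divr_gt0.
have CN0 : `|C| + 1 != 0 by rewrite gt_eqF.
near=> x; rewrite normrM -[leRHS](divfK CN0) ler_pM//.
  by rewrite -normrN -sub0r; near: x.
rewrite (@le_trans _ _ C)//; first by near: x.
by rewrite (le_trans (ler_norm C))// lerDl.
Unshelve. all: by end_near. Qed.

Lemma ebounded_expansion (f E : R -> R) (l : R) : ebounded (0^'+) E ->
  (\forall t \near 0^'+, f t = l + t * E t) -> f t @[t --> 0^'+] --> l.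
Proof.
move=> bE fE; apply/cvgrPdist_le => e e0; near=> t.
rewrite distrC (_ : f t = l + t * E t); last by near: t.
by rewrite addrC addKr; near: t; apply: ebounded_small => //; exact: cvg_at_right_filter cvg_id.
Unshelve. all: by end_near. Qed.

(* Here w stands for Y'^2 / omega^2, written in the variable t. *)
Lemma amplitude_expansion (g dg G D : R -> R) (b l mu K : R) : 0 < l ->
  mu = l * (l + b - 1) / 4 -> K = 1 / 2 + (3 * b + 1) / (2 * l) ->
  ebounded (0^'+) G -> ebounded (0^'+) D ->
  (\forall t \near 0^'+, g t = 1 - l * t + mu * t ^+ 2 + t ^+ 3 * G t) ->
  (\forall t \near 0^'+, dg t = - l + 2 * mu * t + t ^+ 2 * D t) ->
  let w t := t * (1 - t) * dg t ^+ 2 / l in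
  [/\ w t @[t --> 0^'+] --> 0,
      \forall t \near 0^'+, dg t < 0,
      \forall t \near 0^'+, 0 < w t &
      exists2 E, ebounded (0^'+) E & \forall t \near 0^'+,
        g t ^+ 2 + w t = 1 - w t - K * w t ^+ 2 + w t ^+ 3 * E t].
Proof.
move=> l0 muE KE bG bD gE dgE w.
(* Squaring the expansion of g' gives g'^2 = l^2 - 4 l mu t + t^2 M. As 4 mu + l = l (l + b), it
   follows that w = t U with U = l - l (l + b) t + t^2 U2. *)
pose M t := (2 * mu + t * D t) ^+ 2 - 2 * l * D t.
pose U2 t := (M t + 4 * l * mu - t * M t) / l.
pose U1 t := - (l * (l + b)) / l * l + t * U2 t.
pose U t := (1 - t) * dg t ^+ 2 / l.
have bM : ebounded (0^'+) M by ebounded_tac.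
have bU2 : ebounded (0^'+) U2 by ebounded_tac.
have bU1 : ebounded (0^'+) U1 by ebounded_tac.
have lN0 : l != 0 by rewrite gt_eqF.
have UE : \forall t \near 0^'+, U t = l + t * U1 t.
  near=> t; rewrite /U (_ : dg t = - l + 2 * mu * t + t ^+ 2 * D t); last by near: t.
  by rewrite /U1 /U2 /M muE; field.
have Ucvg : U t @[t --> 0^'+] --> l by apply: ebounded_expansion UE.
have bU : ebounded (0^'+) U by exact: ebounded_cvg Ucvg.
have Uge : \forall t \near 0^'+, l / 2 <= U t.
  move: Ucvg => /cvgrPdist_le/(_ (l / 2)); rewrite divr_gt0// => /(_ isT) H.
  near=> t; have : `|l - U t| <= l / 2 by near: t.
  by rewrite ler_norml => /andP[_]; lra.
have wE t : w t = t * U t by rewrite /w /U; ring.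
split.
- apply: (@ebounded_expansion _ U) => //.
  by near=> t; rewrite wE add0r.
- have : dg t @[t --> 0^'+] --> - l.
    apply: (@ebounded_expansion _ (fun t => 2 * mu + t * D t)).
      by ebounded_tac.
    near=> t; rewrite (_ : dg t = - l + 2 * mu * t + t ^+ 2 * D t); last by near: t.
    by ring.
  move=> /cvgrPdist_le/(_ (l / 2)); rewrite divr_gt0// => /(_ isT) H.
  near=> t; have : `|- l - dg t| <= l / 2 by near: t.
  by rewrite ler_norml => /andP[H1 _]; lra.
- near=> t; rewrite wE mulr_gt0// (@lt_le_trans _ _ (l / 2)) ?divr_gt0//.
  by near: t.
(* Here g = 1 - l t + t^2 N, and t^3 S is the cubic remainder of g^2. *)
pose N t := mu + t * G t.
pose S t := 2 * G t - 2 * l * N t + t * N t ^+ 2.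
(* In g^2 + 2 w + K w^2 - 1 the terms in t cancel, and K is the value that cancels those in t^2: l^2
   + 2 mu - 2 l (l + b) + K l^2 = 0. The rest is t^3 times the numerator; dividing by U^3, which
   stays away from 0, turns t^3 into w^3. *)
exists (fun t => (S t + 2 * U2 t + K * (U1 t * (2 * l + t * U1 t))) / U t ^+ 3).
  have bN : ebounded (0^'+) N by ebounded_tac.
  apply: eboundedM; last first.
    apply: (@eboundedV _ _ _ _ _ ((l / 2) ^+ 3)); first by rewrite exprn_gt0// divr_gt0.
    near=> t; have h : l / 2 <= U t by near: t.
    have l2 : 0 <= l / 2 by rewrite divr_ge0 ?ltW.
    by rewrite lerXn2r ?nnegrE// (le_trans l2).
  by ebounded_tac.
near=> t; rewrite !wE.
have Upos : U t != 0.
  by rewrite gt_eqF// (@lt_le_trans _ _ (l / 2)) ?divr_gt0//; near: t.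
have EE X : (t * U t) ^+ 3 * (X / U t ^+ 3) = t ^+ 3 * X by field.
rewrite EE.
rewrite (_ : U t = l + t * U1 t); last by near: t.
rewrite (_ : g t = 1 - l * t + mu * t ^+ 2 + t ^+ 3 * G t); last by near: t.
by rewrite /S /N /U1 KE muE; field.
Unshelve. all: by end_near. Qed.

End PhaseExpansion.

(** * The functions Y_j in the variable t *)

Section Profile.
Context {R : realType}.

Definition half_versin (theta : R) : R := (1 - cos theta) / 2.

Lemma half_versin_gt0 : \forall x \near 0^'+, 0 < half_versin x.
Proof.
near=> x; rewrite divr_gt0// subr_gt0 lt_neqAle cos_le1 andbT.
have : 0 < sin x.
  by apply: sin_gt0_pi; apply/andP; split => //; near: x; apply: nbhs_right_lt; exact: pi_gt0.
apply: contraTneq => c1; have := cos2Dsin2 x; rewrite c1 expr1n => /eqP.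
by rewrite -subr_eq0 addrC addKr sqrf_eq0 => /eqP ->; rewrite ltxx.
Unshelve. all: by end_near. Qed.

(** The limit filter is one-sided so that expansions valid for small t > 0 can be pulled back to
    theta. *)
Lemma half_versin_cvg : half_versin x @[x --> 0^'+] --> 0^'+.
Proof.
have H : half_versin x @[x --> 0^'+] --> 0.
  rewrite [X in _ --> X](_ : _ = half_versin 0); last first.
    by rewrite /half_versin cos0 subrr mul0r.
  apply: cvg_at_right_filter; apply: (@cvgM _ _ _ _ (fun x => 1 - cos x) (fun=> 2^-1)); last exact: cvg_cst.
  by apply: cvgB; [exact: cvg_cst|exact: continuous_cos].
move=> P [e /= e0 HP]; near=> x; apply: HP => /=; last first.
  by near: x; exact: half_versin_gt0.
by near: x; move/cvgrPdist_lt : H; exact.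
Unshelve. all: by end_near. Qed.

Lemma ebounded_comp (T U : Type) (F : set_system T) (G : set_system U)
    (f : T -> U) (E : U -> R) :
  f x @[x --> F] --> G -> ebounded G E -> ebounded F (E \o f).
Proof. by move=> fFG [C HC]; exists C; exact: (fFG _ HC). Qed.

(* profile b p is the function g of the header: Y b j = profile b p \o half_versin
   as soon as p is the Jacobi polynomial read in the variable t = (1 - x) / 2. *)
Definition profile (b : R) (p : {poly R}) (t : R) := (1 - t) `^ (b + 1) * p.[t].

Definition dprofile (b : R) (p : {poly R}) (t : R) :=
  - (b + 1) * (1 - t) `^ b * p.[t] + (1 - t) `^ (b + 1) * p^`().[t].

Lemma is_derive_profile (b : R) p (t : R) : t < 1 ->
  is_derive t (1:R) (profile b p) (dprofile b p t).
Proof.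
move=> t1; have D1 := is_derive_powR_onem (b + 1) t t1.
have D2 := is_derive_poly p t.
rewrite /profile; apply: is_derive_eq.
by rewrite /dprofile addrK /GRing.scale/=; ring.
Qed.

Lemma is_derive_half_versin (x : R) :
  is_derive x (1:R) half_versin (sin x / 2).
Proof.
rewrite /half_versin; apply: is_derive_eq.
by rewrite /GRing.scale/=; ring.
Qed.

(** Since 1 + cos theta = 2 (1 - t), the power of 2 it produces cancels the normalising factor of
    [Q]. *)
Lemma Y_profile (b : R) (j : nat) (p : {poly R}) :
  (forall t, (jacobi 0 (b + 1) j.-1).[1 - 2 * t] = p.[t]) ->
  Y b j = profile b p \o half_versin.
Proof.
move=> pE; apply/funext => x; rewrite /Y /Q /profile /=.
have -> : cos x = 1 - 2 * half_versin x by rewrite /half_versin; field.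
rewrite pE; congr (_ * _).
have -> : 1 + (1 - 2 * half_versin x) = 2 * (1 - half_versin x) by ring.
rewrite powRM//; last by have := cos_geN1 x; rewrite /half_versin; lra.
rewrite mulrA -powRD ?pnatr_eq0 ?implybT//.
by rewrite -opprD addNr powRr0 mul1r.
Qed.

Lemma derive1_Y (b : R) (j : nat) (p : {poly R}) :
  (forall t, (jacobi 0 (b + 1) j.-1).[1 - 2 * t] = p.[t]) ->
  \forall x \near 0^'+, (Y b j)^`()%classic x =
    dprofile b p (half_versin x) * (sin x / 2).
Proof.
move=> /Y_profile ->; near=> x.
have x1 : half_versin x < 1.
  have : 0 < cos x; last by rewrite /half_versin; lra.
  apply: cos_gt0_pihalf; apply/andP; split.
    by rewrite (@lt_trans _ _ 0)// oppr_lt0 divr_gt0// pi_gt0.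
  by near: x; apply: nbhs_right_lt; rewrite divr_gt0// pi_gt0.
rewrite derive1E; apply: derive_val.
apply: is_derive1_comp; first exact: is_derive_profile.
exact: is_derive_half_versin.
Unshelve. all: by end_near. Qed.

(** Here n = j - 1 and l = omega_j^2. The derivative is expanded separately from its explicit
    formula, because a remainder O(t^3) cannot be differentiated. *)
Lemma profile_expansion (b : R) (n : nat) (p : {poly R}) (l mu : R) :
  l = n.+1%:R * (n.+1%:R + b) -> mu = l * (l + b - 1) / 4 ->
  p`_0 = 1 -> p`_1 = - (n%:R * (n%:R + (b + 1) + 1)) ->
  p`_2 = n%:R * (n%:R - 1) * (n%:R + (b + 1) + 1) * (n%:R + (b + 1) + 2) / 4 ->
  (exists2 G, ebounded (0^'+) G & \forall t \near 0^'+,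
    profile b p t = 1 - l * t + mu * t ^+ 2 + t ^+ 3 * G t) /\
  (exists2 D, ebounded (0^'+) D & \forall t \near 0^'+,
    dprofile b p t = - l + 2 * mu * t + t ^+ 2 * D t).
Proof.
move=> lE muE p0 p1E p2E.
have [q] := poly_expansion p; rewrite p0.
set p1 := p`_1 in p1E *; set p2 := p`_2 in p2E * => pq.
have [E3 bE3 HE3] := @powR_onem_expansion3 R (b + 1).
have [E2 bE2 HE2] := @powR_onem_expansion2 R b.
have bq := ebounded_horner q; have bdq := ebounded_horner q^`().
have bp := ebounded_horner p; have bdp := ebounded_horner p^`().
have pt t : p.[t] = 1 + p1 * t + p2 * t ^+ 2 + t ^+ 3 * q.[t].
  by rewrite pq !hornerD hornerM !hornerZ !hornerXn hornerX hornerC.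
have dpt t : p^`().[t] = p1 + 2 * p2 * t + t ^+ 2 * (3 * q.[t] + t * q^`().[t]).
  rewrite pq !derivD derivC !derivZ derivM !derivXn derivX add0r.
  by rewrite !hornerD !hornerM !hornerZ !hornerMn !hornerXn hornerC; ring.
pose a := b + 1; pose h2 := a * (a - 1) / 2.
split.
  (* The witness collects the terms of order at least 3 in the product of the two expansions; [h2]
     is the quadratic coefficient of the power. *)
  exists (fun t => - a * p2 + h2 * p1 + t * (h2 * p2) + E3 t * p.[t]
    + q.[t] * (1 - a * t + h2 * t ^+ 2)); first by ebounded_tac.
  near=> t; rewrite /profile.
  rewrite (_ : (1 - t) `^ (b + 1) = 1 - (b + 1) * t + (b + 1) * (b + 1 - 1) / 2 * t ^+ 2
    + t ^+ 3 * E3 t); last by near: t.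
  by rewrite pt muE lE p1E p2E /h2 /a -natr1; field.
exists (fun t => - a * (p2 + t * q.[t] - b * p1 - t * b * (p2 + t * q.[t]) + E2 t * p.[t])
   + (1 - a * t) * (3 * q.[t] + t * q^`().[t]) - a * (2 * p2)
   + (h2 + t * E3 t) * p^`().[t]); first by ebounded_tac.
near=> t; rewrite /dprofile.
rewrite (_ : (1 - t) `^ (b + 1) = 1 - (b + 1) * t + (b + 1) * (b + 1 - 1) / 2 * t ^+ 2
    + t ^+ 3 * E3 t); last by near: t.
rewrite (_ : (1 - t) `^ b = 1 - b * t + t ^+ 2 * E2 t); last by near: t.
by rewrite pt dpt muE lE p1E p2E /h2 /a -natr1; field.
Unshelve. all: by end_near. Qed.

(** The chain rule gives Y' = g'(t) sin theta / 2, and sin^2 theta / 4 = t (1 - t); hence Y'^2 /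
    omega^2 is the w of [amplitude_expansion] evaluated at [half_versin]. *)
Lemma amplitude_expansion_Y (b : R) (j : nat) : -1 < b -> (0 < j)%N ->
  let w x := (Y b j)^`()%classic x ^+ 2 / omega b j ^+ 2 in
  let K := 1 / 2 + (3 * b + 1) / (2 * omega b j ^+ 2) in
  [/\ w x @[x --> 0^'+] --> 0,
      \forall x \near 0^'+, (Y b j)^`()%classic x < 0,
      \forall x \near 0^'+, 0 < w x &
      exists2 E, ebounded (0^'+) E & \forall x \near 0^'+,
        r b j x ^+ 2 = 1 - w x - K * w x ^+ 2 + w x ^+ 3 * E x].
Proof.
case: j => // n b1 _ w K.
have l0 : 0 < n.+1%:R * (n.+1%:R + b).
  by rewrite mulr_gt0// -natr1; have := ler0n R n; lra.
have omE : omega b n.+1 ^+ 2 = n.+1%:R * (n.+1%:R + b) by rewrite sqr_sqrtr// ltW.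
set l := n.+1%:R * _ in l0 omE.
have [p pE [p0 p1 p2]] := @jacobi_onem2 R (b + 1) n.
have [[G bG HG] [D bD HD]] := @profile_expansion b n p l _ erefl erefl p0 p1 p2.
pose v t := t * (1 - t) * dprofile b p t ^+ 2 / l.
have [] := @amplitude_expansion R _ _ _ _ b l _ K l0 erefl _ bG bD HG HD.
  by rewrite /K omE.
rewrite -/v => v0 dg0 vgt0 [E bE HE].
have cv := half_versin_cvg.
have dY := @derive1_Y b n.+1 p pE.
have wE : \forall x \near 0^'+, w x = v (half_versin x).
  near=> x; rewrite /w /v omE.
  rewrite (_ : (Y _ _)^`()%classic x = dprofile b p (half_versin x) * (sin x / 2)); last by near: x.
  rewrite exprMn expr_div_n sin2cos2 (_ : cos x = 1 - 2 * half_versin x); last first.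
    by rewrite /half_versin; field.
  by field; rewrite gt_eqF.
split.
- have : v (half_versin x) @[x --> 0^'+] --> 0 by exact: (cvg_comp half_versin v cv v0).
  by apply: cvg_trans; apply: near_eq_cvg; near=> x; apply/esym; near: x.
- near=> x; rewrite (_ : (Y _ _)^`()%classic x = dprofile b p (half_versin x) * (sin x / 2)); last by near: x.
  rewrite pmulr_llt0; first by near: x; exact: (cv _ dg0).
  rewrite divr_gt0//; apply: sin_gt0_pi; apply/andP; split => //.
  by near: x; apply: nbhs_right_lt; exact: pi_gt0.
- near=> x; rewrite (_ : w x = v (half_versin x)); last by near: x.
  by near: x; exact: (cv _ vgt0).
exists (E \o half_versin); first exact: ebounded_comp bE.
near=> x; rewrite /r sqr_sqrtr; last first.
  by rewrite addr_ge0// ?divr_ge0// sqr_ge0.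
rewrite -/(w x) (_ : w x = v (half_versin x)); last by near: x.
rewrite (Y_profile b n.+1 p pE) /=.
by near: x; exact: (cv _ HE).
Unshelve. all: by end_near. Qed.

End Profile.

(** * The phase s as independent variable *)

Section Phase.
Context {R : realType}.

Lemma sin_gt0_small (x : R) : `|x| < 1 -> 0 < sin x -> 0 < x.
Proof.
move=> x1 sx; rewrite ltNge; apply: contraTN sx => x0.
rewrite -leNgt -oppr_ge0 -sinN; apply: sin_ge0_pi.
rewrite oppr_ge0 x0 /= (le_trans _ (@pi_ge2 R))//.
by move: x1; rewrite ltr_norml => /andP[]; lra.
Qed.

(* The continuity of phi is known only on `[0, d0], which may be shorter than the
   interval on which Theta inverts phi; hence Theta s is located through a
   preimage of s in a small interval provided by the IVT. *)
Lemma local_inverse_right (b : R) (j : nat) (phi Theta : R -> R) :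
  -1 < b -> (0 < j)%N -> is_local_phase b j phi -> is_local_inverse phi Theta ->
  Theta s @[s --> 0^'+] --> 0^'+ /\
  \forall s \near 0^'+, (Y b j)^`()%classic (Theta s) =
    - omega b j * r b j (Theta s) * sin s.
Proof.
move=> b1 j0 [phi0 [d0 d0_gt0 [phic phiE]]] [d [e [d_gt0 e_gt0 Thphi _]]].
have [_ dY0 _ _] := amplitude_expansion_Y b j b1 j0.
have [_ phic0 _] := (continuous_within_itvP phi d0_gt0).1 phic.
have phi1 : \forall x \near 0^'+, `|phi x| < 1.
  move: phic0; rewrite phi0 => /cvgrPdist_lt/(_ 1 ltr01) H.
  by near=> x; rewrite -normrN -sub0r; near: x.
have key (eps : R) : 0 < eps -> \forall s \near 0^'+,
    0 < Theta s < eps /\ (Y b j)^`()%classic (Theta s) =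
    - omega b j * r b j (Theta s) * sin s.
  move=> eps0.
  have [dl] : exists dl, [/\ 0 < dl, dl < eps, dl <= d0, dl <= d & 0 < phi dl].
    apply: (@filter_ex _ (0:R)^'+); near=> x; split.
    - by near: x; exact: nbhs_right_gt.
    - by near: x; exact: nbhs_right_lt.
    - by near: x; exact: nbhs_right_le.
    - by near: x; exact: nbhs_right_le.
    (* As Y' = - omega r sin phi is negative and omega, r are nonnegative, sin phi > 0; with |phi| <
       1 this gives phi > 0. *)
    apply: sin_gt0_small; first by near: x.
    have [|_ H] := phiE x.
      by apply/andP; split => //; near: x; exact: nbhs_right_le.
    have : (Y b j)^`()%classic x < 0 by near: x.
    rewrite H !mulNr oppr_lt0; apply: contraTT; rewrite -!leNgt => sx.
    by apply: mulr_ge0_le0 => //; rewrite mulr_ge0// sqrtr_ge0.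
  move=> [dl0 dleps dld0 dld phidl].
  have phicdl : {within `[0, dl], continuous phi}.
    apply: continuous_subspaceW phic; apply: subset_itvl.
    by rewrite bnd_simp.
  near=> s; have s0 : 0 < s by [].
  have sphi : s <= phi dl by near: s; exact: nbhs_right_le.
  have [|x] := IVT (ltW dl0) phicdl (v := s).
    by rewrite phi0 min_l ?max_r ?ltW ?s0.
  rewrite in_itv/= => /andP[x0 xdl] phix.
  (* The bound [dl <= d] lets [Theta] undo phi at this preimage, so Theta s lies in the small
     interval. *)
  have <- : x = Theta s by rewrite -phix Thphi// x0 (le_trans xdl).
  have xgt0 : 0 < x.
    rewrite lt_neqAle x0 andbT; apply: contraTneq s0 => x00.
    by rewrite -phix -x00 phi0 ltxx.
  rewrite xgt0 (le_lt_trans xdl)//; split => //.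
  by have [|_ ->] := phiE x; rewrite ?phix// x0 (le_trans xdl).
split; last by near=> s; have [] : 0 < Theta s < 1 /\ (Y b j)^`()%classic (Theta s) =
    - omega b j * r b j (Theta s) * sin s by near: s; exact: (key _ ltr01).
move=> P [eps /= eps0 HP]; apply: filterS (key _ eps0) => s [/andP[T0 Te] _].
by apply: HP => //=; rewrite sub0r normrN gtr0_norm.
Unshelve. all: by end_near. Qed.

(** The phase equation turns w(Theta s) into rho sin^2 s, so the expansion in w becomes an implicit
    equation for rho in which j enters only through K and the remainder. The bounds on rho keep r
    away from 0. *)
Lemma amplitude_expansion_phase (b : R) (j : nat) (phi Theta : R -> R) :
  -1 < b -> (0 < j)%N -> is_local_phase b j phi -> is_local_inverse phi Theta ->
  let rho s := r b j (Theta s) ^+ 2 in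
  let K := 1 / 2 + (3 * b + 1) / (2 * omega b j ^+ 2) in
  (\forall s \near 0^'+, 1 / 2 <= rho s <= 3 / 2) /\
  exists2 E, ebounded (0^'+) E & \forall s \near 0^'+,
    rho s = 1 - rho s * sin s ^+ 2 - K * (rho s * sin s ^+ 2) ^+ 2
            + (rho s * sin s ^+ 2) ^+ 3 * E s.
Proof.
move=> b1 j0 hphi hTheta rho K.
have [Tcv dYE] := local_inverse_right b j phi Theta b1 j0 hphi hTheta.
have [] := amplitude_expansion_Y b j b1 j0.
rewrite -/K.
pose w x := (Y b j)^`()%classic x ^+ 2 / omega b j ^+ 2.
rewrite -/w => w0 _ wgt0 [E bE HE].
have wE : \forall s \near 0^'+, w (Theta s) = rho s * sin s ^+ 2.
  have wgt0s : \forall s \near 0^'+, 0 < w (Theta s) by exact: (Tcv _ wgt0).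
  near=> s; have : 0 < w (Theta s) by near: s.
  rewrite /w (_ : (Y b j)^`()%classic (Theta s) =
    - omega b j * r b j (Theta s) * sin s); last by near: s.
  (* Division by 0 yields 0, so omega = 0 would contradict w > 0. *)
  have [->|om0 _] := eqVneq (omega b j) 0; first by rewrite expr0n invr0 mulr0 ltxx.
  by rewrite /rho; field.
have rhoE : \forall s \near 0^'+, rho s = 1 - w (Theta s) - K * w (Theta s) ^+ 2
    + w (Theta s) ^+ 3 * E (Theta s) by exact: (Tcv _ HE).
have wT0 : w (Theta s) @[s --> 0^'+] --> 0 by exact: (cvg_comp Theta w Tcv w0).
have bw : ebounded 0^'+ (fun s => w (Theta s)) by exact: ebounded_cvg wT0.
have bET : ebounded 0^'+ (fun s => E (Theta s)) by exact: ebounded_comp Tcv bE.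
split.
  (* rho - 1 is w times this bounded factor, and w tends to 0. *)
  have bB : ebounded (0^'+) (fun s => - 1 - K * w (Theta s) + w (Theta s) ^+ 2 * E (Theta s)).
    by ebounded_tac.
  have small : \forall s \near 0^'+, `|w (Theta s) *
      (- 1 - K * w (Theta s) + w (Theta s) ^+ 2 * E (Theta s))| <= 1 / 2.
    by apply: ebounded_small => //; rewrite divr_gt0.
  near=> s.
  rewrite (_ : rho s = 1 + w (Theta s) * (- 1 - K * w (Theta s) + w (Theta s) ^+ 2 * E (Theta s))).
    have : `|w (Theta s) * (- 1 - K * w (Theta s) + w (Theta s) ^+ 2 * E (Theta s))| <= 1 / 2.
      by near: s.
    by rewrite ler_norml => /andP[]; lra.
  rewrite [LHS](_ : _ = 1 - w (Theta s) - K * w (Theta s) ^+ 2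
    + w (Theta s) ^+ 3 * E (Theta s)); last by near: s.
  by ring.
exists (E \o Theta) => //; near=> s.
rewrite -(_ : w (Theta s) = rho s * sin s ^+ 2); last by near: s.
by near: s.
Unshelve. all: by end_near. Qed.

(** Each square rho = r^2 satisfies (1 + v) rho = 1 - K rho^2 v^2 + O(v^3) with rho = 1 + O(v).
    Subtracting leaves -(Kb - Ka) v^2 + O(v^3); division by 1 + v and by ra + rb = 2 + O(v) gives
    the claim. *)
Lemma amplitude_diff_expansion (ra rb v Ea Eb : R -> R) (F : set_system R)
  (Ka Kb : R) : ProperFilter F ->
  (forall s, 0 <= ra s) -> (forall s, 0 <= rb s) -> (forall s, 0 <= v s) ->
  ebounded F v -> ebounded F Ea -> ebounded F Eb ->
  (\forall s \near F, 1 / 2 <= ra s ^+ 2 <= 3 / 2) ->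
  (\forall s \near F, 1 / 2 <= rb s ^+ 2 <= 3 / 2) ->
  (\forall s \near F, ra s ^+ 2 = 1 - ra s ^+ 2 * v s - Ka * (ra s ^+ 2 * v s) ^+ 2
     + (ra s ^+ 2 * v s) ^+ 3 * Ea s) ->
  (\forall s \near F, rb s ^+ 2 = 1 - rb s ^+ 2 * v s - Kb * (rb s ^+ 2 * v s) ^+ 2
     + (rb s ^+ 2 * v s) ^+ 3 * Eb s) ->
  exists2 D, ebounded F D & \forall s \near F,
    rb s - ra s = - (Kb - Ka) / 2 * v s ^+ 2 + v s ^+ 3 * D s.
Proof.
move=> FF ra0 rb0 v0 bv bEa bEb bra brb raE rbE.
pose rho (r : R -> R) s := r s ^+ 2.
have brho (r : R -> R) : (\forall s \near F, 1 / 2 <= r s ^+ 2 <= 3 / 2) ->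
    ebounded F (rho r).
  move=> H; exists (3 / 2); near=> s; rewrite ger0_norm ?sqr_ge0//.
  by have /andP[] : 1 / 2 <= r s ^+ 2 <= 3 / 2 by near: s.
have brhoa := brho _ bra; have brhob := brho _ brb.
have bV1 : ebounded F (fun s => (1 + v s)^-1).
  by apply: (eboundedV _ 1) => //; near=> s; rewrite lerDl.
have bVr (r : R -> R) : (forall s, 0 <= r s) -> ebounded F (fun s => (1 + r s)^-1).
  by move=> r0; apply: (eboundedV _ 1) => //; near=> s; rewrite lerDl.
have bVa := bVr _ ra0; have bVb := bVr _ rb0.
have rge (r : R -> R) s : 0 <= r s -> 1 / 2 <= r s ^+ 2 <= 3 / 2 -> 1 / 2 <= r s.
  by move=> r0 /andP[h _]; nra.
have bVs : ebounded F (fun s => (ra s + rb s)^-1).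
  apply: (eboundedV _ 1) => //; near=> s.
  have : 1 / 2 <= ra s by apply: rge => //; near: s.
  have : 1 / 2 <= rb s by apply: rge => //; near: s.
  by lra.
(* [A] is the bounded factor in rho = 1 + v A. *)
pose A K (r E : R -> R) s := - rho r s - K * rho r s ^+ 2 * v s
  + rho r s ^+ 3 * v s ^+ 2 * E s.
pose Aa := A Ka ra Ea; pose Ab := A Kb rb Eb.
have bA K r E : ebounded F (rho r) -> ebounded F E -> ebounded F (A K r E).
  by move=> b1 b2; ebounded_tac.
have bAa := bA Ka _ _ brhoa bEa; have bAb := bA Kb _ _ brhob bEb.
(* v^3 [D1] is the remainder of (1 + v)(rb^2 - ra^2) and v^3 [D2] that of rb^2 - ra^2; the extra
   [Kb - Ka] comes from v^2 / (1 + v) = v^2 - v^3 / (1 + v). *)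
pose D1 s := rho rb s ^+ 3 * Eb s - rho ra s ^+ 3 * Ea s
  - Kb * (2 * Ab s + v s * Ab s ^+ 2) + Ka * (2 * Aa s + v s * Aa s ^+ 2).
pose D2 s := (D1 s + (Kb - Ka)) * (1 + v s)^-1.
have bD2 : ebounded F D2 by rewrite /D2 /D1; ebounded_tac.
pose D3 s := - (Aa s * (1 + ra s)^-1 + Ab s * (1 + rb s)^-1) / 2 * (ra s + rb s)^-1.
have bD3 : ebounded F D3 by rewrite /D3; ebounded_tac.
exists (fun s => D2 s * (ra s + rb s)^-1 - (Kb - Ka) * D3 s); first by ebounded_tac.
near=> s.
have ha : ra s ^+ 2 = 1 + v s * Aa s.
  rewrite [LHS](_ : _ = 1 - ra s ^+ 2 * v s - Ka * (ra s ^+ 2 * v s) ^+ 2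
     + (ra s ^+ 2 * v s) ^+ 3 * Ea s); last by near: s.
  by rewrite /Aa /A /rho; ring.
have hb : rb s ^+ 2 = 1 + v s * Ab s.
  rewrite [LHS](_ : _ = 1 - rb s ^+ 2 * v s - Kb * (rb s ^+ 2 * v s) ^+ 2
     + (rb s ^+ 2 * v s) ^+ 3 * Eb s); last by near: s.
  by rewrite /Ab /A /rho; ring.
have ra1 : 1 / 2 <= ra s by apply: rge => //; near: s.
have rb1 : 1 / 2 <= rb s by apply: rge => //; near: s.
have ra1N0 : 1 + ra s != 0 by rewrite gt_eqF//; lra.
have rb1N0 : 1 + rb s != 0 by rewrite gt_eqF//; lra.
have rsN0 : ra s + rb s != 0 by rewrite gt_eqF//; lra.
have vN0 : 1 + v s != 0 by rewrite gt_eqF// ltr_wpDr.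
have rhoD : rb s ^+ 2 - ra s ^+ 2 = - (Kb - Ka) * v s ^+ 2 + v s ^+ 3 * D2 s.
  apply: (mulfI vN0).
  have -> : (1 + v s) * (- (Kb - Ka) * v s ^+ 2 + v s ^+ 3 * D2 s) =
    - (Kb - Ka) * v s ^+ 2 + v s ^+ 3 * D1 s by rewrite /D2; field.
  have ea : ra s ^+ 2 * v s = - v s * Aa s - Ka * (1 + v s * Aa s) ^+ 2 * v s ^+ 2
     + v s ^+ 3 * rho ra s ^+ 3 * Ea s by rewrite -ha /Aa /A /rho; ring.
  have eb : rb s ^+ 2 * v s = - v s * Ab s - Kb * (1 + v s * Ab s) ^+ 2 * v s ^+ 2
     + v s ^+ 3 * rho rb s ^+ 3 * Eb s by rewrite -hb /Ab /A /rho; ring.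
  rewrite mulrDl mul1r mulrBr ![v s * (_ ^+ 2)]mulrC ea eb ha hb /D1.
  by ring.
(* r - 1 = (r^2 - 1) / (1 + r), so 1 / (ra + rb) is 1 / 2 up to O(v). *)
have half : (ra s + rb s)^-1 = 1 / 2 + v s * D3 s.
  have ea : v s * Aa s = (ra s - 1) * (1 + ra s).
    by rewrite -(addKr 1 (v s * Aa s)) -ha; ring.
  have eb : v s * Ab s = (rb s - 1) * (1 + rb s).
    by rewrite -(addKr 1 (v s * Ab s)) -hb; ring.
  have -> : v s * D3 s = - (v s * Aa s * (1 + ra s)^-1 + v s * Ab s * (1 + rb s)^-1) / 2
    * (ra s + rb s)^-1 by rewrite /D3; ring.
  by rewrite ea eb; field; rewrite ra1N0 rb1N0 rsN0.
have -> : rb s - ra s = (rb s ^+ 2 - ra s ^+ 2) * (ra s + rb s)^-1 by field.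
(* Only the v^2 term needs 1 / (ra + rb) expanded; beside v^3 [D2] the factor is restored, being
   bounded. *)
rewrite rhoD mulrDl [X in X + _]mulrC half mulrDl.
have -> : 1 / 2 + v s * D3 s = (ra s + rb s)^-1 by rewrite half.
by field.
Unshelve. all: by end_near. Qed.

End Phase.

(** * Comparison of R_m and R_(m+1) *)

Theorem proposition4p6 (R : realType) (beta : R) (m : nat)
    (phi Theta : nat -> R -> R)
    (hbeta : - 1 < beta < - (1 / 3)) (hm : (1 <= m)%N)
    (hphi : forall j : nat, j \in [:: m; m.+1] -> is_local_phase beta j (phi j))
    (hTheta : forall j : nat, j \in [:: m; m.+1] ->
       is_local_inverse (phi j) (Theta j)) :
  let RR := fun (j : nat) (s : R) => r beta j (Theta j s) in
  ((fun s : R => RR m.+1 s - RR m s) =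
     (fun s : R => (3 * beta + 1) / 4
        * (1 / omega beta m ^+ 2 - 1 / omega beta m.+1 ^+ 2) * s ^+ 4)
     +O_ (0^'+) (fun s : R => s ^+ 6)) /\
  (\forall s \near 0^'+, RR m.+1 s < RR m s).
Proof.
move=> RR.
have /andP[b1 b3] := hbeta.
have mm : m \in [:: m; m.+1] by rewrite !inE eqxx.
have mm1 : m.+1 \in [:: m; m.+1] by rewrite !inE eqxx orbT.
have [ba [Ea bEa HEa]] := amplitude_expansion_phase beta m _ _ b1 hm (hphi _ mm) (hTheta _ mm).
have [bb [Eb bEb HEb]] := amplitude_expansion_phase beta m.+1 _ _ b1 isT (hphi _ mm1) (hTheta _ mm1).
have [S bS HS] := @sin_expansion R.
pose c := (3 * beta + 1) / 4 * (1 / omega beta m ^+ 2 - 1 / omega beta m.+1 ^+ 2).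
have lE j : (0 < j)%N -> omega beta j ^+ 2 = j%:R * (j%:R + beta) /\ 0 < omega beta j ^+ 2.
  move=> j0; have j1 : 1 <= j%:R :> R by rewrite ler1n.
  have h : 0 < j%:R * (j%:R + beta) by rewrite mulr_gt0//; lra.
  by rewrite sqr_sqrtr// ltW.
have [la la0] := lE _ hm; have [lb lb0] := lE m.+1 isT.
have oa0 : omega beta m != 0 by apply: contraTneq la0 => ->; rewrite expr0n ltxx.
have ob0 : omega beta m.+1 != 0 by apply: contraTneq lb0 => ->; rewrite expr0n ltxx.
have [||||D bD HD] := @amplitude_diff_expansion R (RR m) (RR m.+1) (fun s => sin s ^+ 2)
   Ea Eb 0^'+ _ _ _ _ _ _ _ bEa bEb ba bb HEa HEb.
- by move=> s; exact: sqrtr_ge0.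
- by move=> s; exact: sqrtr_ge0.
- by move=> s; exact: sqr_ge0.
- apply: (ebounded_cvg _ (sin 0 ^+ 2)); apply: cvg_at_right_filter.
  by apply: cvgM; exact: continuous_sin.
have [E bE HE] : exists2 E, ebounded (0^'+) E & \forall s \near 0^'+,
    RR m.+1 s - RR m s = c * s ^+ 4 + s ^+ 6 * E s.
  (* With sin s = s (1 + u), sin^4 s - s^4 = s^4 u (4 + 6 u + 4 u^2 + u^3), and s^4 u = s^6 S; the
     factor (1 + u)^6 comes from sin^6 s. *)
  pose u s := s ^+ 2 * S s.
  exists (fun s => c * S s * (4 + 6 * u s + 4 * u s ^+ 2 + u s ^+ 3)
    + (1 + u s) ^+ 6 * D s); first by rewrite /u; ebounded_tac.
  near=> s.
  rewrite [LHS](_ : _ = - (1 / 2 + (3 * beta + 1) / (2 * omega beta m.+1 ^+ 2)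
    - (1 / 2 + (3 * beta + 1) / (2 * omega beta m ^+ 2))) / 2 * (sin s ^+ 2) ^+ 2
    + (sin s ^+ 2) ^+ 3 * D s); last by near: s.
  rewrite (_ : sin s = s + s ^+ 3 * S s); last by near: s.
  by rewrite /c /u; field; rewrite oa0 ob0.
split.
  apply/eqaddOP; have [C HC] := bE.
  near=> k; have Ck : C <= k by near: k; apply: nbhs_pinfty_ge; exact: num_real.
  near=> s; rewrite /=.
  rewrite [X in `|X|](_ : _ = s ^+ 6 * E s); last first.
    rewrite !fctE -/c (_ : RR m.+1 s - RR m s = c * s ^+ 4 + s ^+ 6 * E s); last by near: s.
    by rewrite addrC addKr.
  have Es : `|E s| <= C by near: s.
  by rewrite normrM mulrC ler_wpM2r// (le_trans Es).
(* beta < -1/3 makes 3 beta + 1 negative, and omega_(m+1)^2 - omega_m^2 = 2 m + 1 + beta > 0. *)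
have c0 : c < 0.
  rewrite /c pmulr_llt0.
    by rewrite pmulr_llt0 ?invr_gt0//; lra.
  rewrite subr_gt0 !div1r ltf_pV2 ?posrE// la lb -natr1.
  have m1 : 1 <= m%:R :> R by rewrite ler1n.
  by nra.
(* The difference is s^4 (c + s^2 E), and this bound makes the bracket at most c/2 < 0. *)
have small : \forall s \near 0^'+, `|s ^+ 2 * E s| <= - c / 2.
  apply: ebounded_small => //; last by rewrite divr_gt0// oppr_gt0.
  rewrite [X in _ --> X](_ : _ = (0:R) ^+ 2); last by rewrite expr0n.
  by apply: cvg_at_right_filter; exact: exprn_continuous.
near=> s.
suff : RR m.+1 s - RR m s < 0 by rewrite subr_lt0.
rewrite (_ : RR m.+1 s - RR m s = c * s ^+ 4 + s ^+ 6 * E s); last by near: s.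
have -> : c * s ^+ 4 + s ^+ 6 * E s = s ^+ 4 * (c + s ^+ 2 * E s) by ring.
rewrite pmulr_rlt0 ?exprn_gt0//.
have : `|s ^+ 2 * E s| <= - c / 2 by near: s.
by rewrite ler_norml => /andP[_]; lra.
Unshelve. all: by end_near. Qed.
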